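(* Let $Y = X\beta^* + \varepsilon$ be a linear regression model with design matrix $X\in\mathbb{R}^{n\times p}$, regression vector $\beta^*\in\mathbb{R}^p$ and random noise vector $\varepsilon\in\mathbb{R}^n$ satisfying $\max_{i\in\{1,\dots,n\}}\mathbb{E}[\varepsilon_i^2]<\infty$. Let $\Lambda=\{\lambda_1,\dots,\lambda_N\}$ be a finite grid of tuning parameters with $0<\lambda_1<\dots<\lambda_N=\lambda_{\max}$, where $\lambda_{\max}:=2\|X^\top Y\|_\infty/n$, and for each $\lambda\in\Lambda$ let $\widehat\beta_\lambda$ be the Lasso estimator with tuning parameter $\lambda$. Suppose that Assumption $\ell_\infty(C)$ holds, and let the $\mathrm{AV}_\infty$ method be implemented with a constant $\overline{C}\ge C$. Then for any $\delta\in(0,1)$, the output pair $(\hat\lambda,\widehat\beta_{\hat\lambda})$ of the $\mathrm{AV}_\infty$ rule satisfies the bounds $$\hat\lambda\le\lambda^*_\delta\qquad\text{and}\qquad \|\widehat\beta_{\hat\lambda}-\beta^*\|_\infty\le 3\,\overline{C}\,\lambda^*_\delta$$ with probability at least $1-\delta$, where $\lambda^*_\delta$ is the oracle tuning parameter.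
   Context: $p$ may be larger than $n$. Lasso: for $\lambda>0$, $\widehat\beta_\lambda\in\arg\min_{\beta\in\mathbb{R}^p}\{\|Y-X\beta\|_2^2/n+\lambda\|\beta\|_1\}$. The value $\lambda_{\max}$ is the smallest tuning parameter for which $\widehat\beta_\lambda$ equals zero. Event: $\mathcal{T}_\lambda := \{\|X^\top\varepsilon\|_\infty/n\le\lambda/4\}$. Assumption $\ell_\infty(C)$: there is a numerical constant $C$ such that, conditioned on $\mathcal{T}_\lambda$, the Lasso satisfies $\|\widehat\beta_\lambda-\beta^*\|_\infty\le C\lambda$. Oracle tuning parameter: for $\delta\in(0,1)$, $\lambda^*_\delta$ is the smallest $\lambda\in\Lambda$ such that $\mathbb{P}(\mathcal{T}_\lambda)\ge 1-\delta$ (it is assumed that such a $\lambda\in\Lambda$ exists). $\mathrm{AV}_\infty$ rule with constant $\overline{C}$: $$\hat\lambda := \min\Big\{\lambda\in\Lambda \;\Big|\; \max_{\lambda',\lambda''\in\Lambda,\ \lambda',\lambda''\ge\lambda}\Big[\frac{\|\widehat\beta_{\lambda'}-\widehat\beta_{\lambda''}\|_\infty}{\lambda'+\lambda''}-\overline{C}\Big]\le 0\Big\}.$$ *)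

(* Defs.v *)
From HB Require Import structures.
From mathcomp Require Import all_boot all_order all_algebra.
From mathcomp Require Import all_classical all_reals all_analysis.

Set Implicit Arguments.
Unset Strict Implicit.
Unset Printing Implicit Defensive.

Import Order.TTheory GRing.Theory Num.Theory.
Import numFieldNormedType.Exports.

Local Open Scope classical_set_scope.
Local Open Scope ring_scope.

(* Throughout, `|v| on a column vector v is the library norm on matrices, that
   is, the sup norm max_i |v_i|. *)

Definition is_min (R : realType) (A : set R) (x : R) : Prop :=
  A x /\ lbound A x.

(* Inner probability: the event A need not be measurable, since neither the
   selection of a Lasso minimizer nor the data-dependent grid is assumed to be
   measurable. For measurable A this is equivalent to q <= P A. *)
Definition with_prob_at_least (d : measure_display) (T : measurableType d)
    (R : realType) (P : probability T R) (q : R) (A : set T) : Prop :=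
  exists E : set T, [/\ measurable E, E `<=` A & (q%:E <= P E)%E].

Definition noise_vec (d : measure_display) (T : measurableType d)
    (R : realType) (P : probability T R) (n : nat)
    (eps : 'I_n -> {RV P >-> R}) (w : T) : 'cV[R]_n :=
  \col_i eps i w.

Definition response (d : measure_display) (T : measurableType d)
    (R : realType) (P : probability T R) (n p : nat) (X : 'M[R]_(n, p))
    (bstar : 'cV[R]_p) (eps : 'I_n -> {RV P >-> R}) (w : T) : 'cV[R]_n :=
  X *m bstar + noise_vec eps w.

Definition lasso_objective (R : realType) (n p : nat) (X : 'M[R]_(n, p))
    (Y : 'cV[R]_n) (lambda : R) (b : 'cV[R]_p) : R :=
  (\sum_i (Y - X *m b) i 0 ^+ 2) / n%:R + lambda * \sum_j `|b j 0|.

(* The minimizer may be non-unique (p may exceed n). *)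
Definition is_lasso (R : realType) (n p : nat) (X : 'M[R]_(n, p))
    (Y : 'cV[R]_n) (lambda : R) (bhat : 'cV[R]_p) : Prop :=
  forall b : 'cV[R]_p,
    lasso_objective X Y lambda bhat <= lasso_objective X Y lambda b.

Definition lambda_max (R : realType) (n p : nat) (X : 'M[R]_(n, p))
    (Y : 'cV[R]_n) : R :=
  2 * `|X^T *m Y| / n%:R.

(* s = [:: l_1; ...; l_N] with N >= 1 and 0 < l_1 < ... < l_N = lmax. *)
Definition is_grid (R : realType) (lmax : R) (s : seq R) : Prop :=
  [/\ s != [::], path <%R 0 s & last 0 s = lmax].

Definition noise_event (d : measure_display) (T : measurableType d)
    (R : realType) (P : probability T R) (n p : nat) (X : 'M[R]_(n, p))
    (eps : 'I_n -> {RV P >-> R}) (lambda : R) : set T :=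
  [set w | `|X^T *m noise_vec eps w| / n%:R <= lambda / 4].

(* Almost surely, the sup-norm error bound holds on the noise event, for all
   tuning parameters of the realized grid simultaneously. *)
Definition linf_assumption (d : measure_display) (T : measurableType d)
    (R : realType) (P : probability T R) (n p : nat) (X : 'M[R]_(n, p))
    (bstar : 'cV[R]_p) (eps : 'I_n -> {RV P >-> R}) (Lam : T -> seq R)
    (bhat : R -> T -> 'cV[R]_p) (C : R) : Prop :=
  {ae P, forall w, forall lambda : R, lambda \in Lam w ->
    noise_event X eps lambda w -> `|bhat lambda w - bstar| <= C * lambda}.

Definition oracle_set (d : measure_display) (T : measurableType d)
    (R : realType) (P : probability T R) (n p : nat) (X : 'M[R]_(n, p))
    (eps : 'I_n -> {RV P >-> R}) (delta : R) (s : seq R) : set R :=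
  [set lambda | lambda \in s
    /\ ((1 - delta)%:E <= P (noise_event X eps lambda))%E].

(* The maximum is taken in \bar R so that -oo can serve as a neutral default;
   it ranges over a nonempty set of pairs as soon as lambda \in s. *)
Definition av_set (R : realType) (p : nat) (s : seq R) (b : R -> 'cV[R]_p)
    (Cbar : R) : set R :=
  [set lambda | lambda \in s
    /\ (\big[maxe/-oo]_(l1 <- s | (lambda <= l1)%R)
         \big[maxe/-oo]_(l2 <- s | (lambda <= l2)%R)
           (`|b l1 - b l2| / (l1 + l2) - Cbar)%:E <= 0)%E].

(* Main.v *)
(* Both conclusions are deterministic on the noise event at the oracle
   parameter: that event is monotone in the parameter, so the sup-norm bound
   holds at every grid point above the oracle, the triangle inequality through
   bstar makes the oracle admissible for the AV test, and the test at
   (lhat, lstar) then yields 2 * Cbar * lstar + Cbar * lstar.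

   The grid, hence the oracle parameter lstar, may depend on the data w, so
   that P (noise_event lstar) >= 1 - delta for each fixed lstar does not bound
   the probability that w lies in the noise event at lstar(w). But every
   possible lstar lies above the (1 - delta)-quantile l0 of
   4 * `|X^T *m eps| / n, and right continuity of the distribution function
   gives the fixed event at l0 probability at least 1 - delta. *)
Require Import Defs.
From HB Require Import structures.
From mathcomp Require Import all_boot all_order all_algebra.
From mathcomp Require Import all_classical all_reals all_analysis.
From mathcomp Require Import measurable_realfun lra.

Set Implicit Arguments.
Unset Strict Implicit.
Unset Printing Implicit Defensive.

Import Order.TTheory GRing.Theory Num.Theory.
Import numFieldNormedType.Exports.

Local Open Scope classical_set_scope.
Local Open Scope ring_scope.

(** Induction on the list: unless [A] is just the head [a], the minimum of [A] without [a] is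
    compared with [a]. *)
Lemma seq_has_min (R : realType) (s : seq R) (A : set R) (x : R) :
  A `<=` [set` s] -> A x -> exists m, is_min A m.
Proof.
elim: s A x => [|a s IH] A x As Ax; first by have := As _ Ax.
have [[y [Ay yNa]]|noy] := pselect (exists y, A y /\ y <> a); last first.
  have Aa z : A z -> z = a.
    by move=> Az; apply: contrapT => za; apply: noy; exists z.
  exists a; split=> [|z /Aa ->//]; by rewrite -(Aa _ Ax).
have [z /= | | m [[Am mNa] mlb]] := IH (A `\ a) y.
- by move=> [Az /eqP/negbTE za]; have := As _ Az; rewrite /= inE za.
- by split.
have [Aa|NAa] := pselect (A a); last first.
  exists m; split=> // z Az; apply: mlb; split=> // za.
  by apply: NAa; rewrite -za.
have [am|ma] := leP a m.
  exists a; split=> // z Az; have [->//|/eqP za] := eqVneq z a.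
  by rewrite (le_trans am)// mlb.
exists m; split=> // z Az; have [->|/eqP za] := eqVneq z a; first exact: ltW.
exact: mlb.
Qed.

Lemma bigmax_seq_le (d : Order.disp_t) (T : orderType d) (I : eqType)
    (s : seq I) (P : pred I) (F : I -> T) (x m : T) : (x <= m)%O ->
  (\big[Order.max/x]_(i <- s | P i) F i <= m)%O <->
  (forall i, i \in s -> P i -> (F i <= m)%O).
Proof.
move=> xm; split=> [Fm i si Pi|Fm].
  exact: le_trans (le_bigmax_seq _ _ _ _ si Pi) Fm.
by rewrite big_seq_cond; apply: bigmax_le => // i /andP[]; exact: Fm.
Qed.

(** The default [-oo] lies below 0, so the nested maxima are at most 0 iff every term is; positivity
    of the grid then clears the denominator [l1 + l2]. *)
Lemma av_setP (R : realType) (p : nat) (s : seq R) (b : R -> 'cV[R]_p)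
    (Cbar l : R) : {in s, forall x, 0 < x} ->
  av_set s b Cbar l <-> l \in s /\
  forall l1 l2, l1 \in s -> l2 \in s -> l <= l1 -> l <= l2 ->
    `|b l1 - b l2| <= Cbar * (l1 + l2).
Proof.
move=> s0.
suff E l1 l2 : l1 \in s -> l2 \in s ->
    ((`|b l1 - b l2| / (l1 + l2) - Cbar)%:E <= 0)%E =
    (`|b l1 - b l2| <= Cbar * (l1 + l2)).
  split=> -[ls H]; split=> //.
    move=> l1 l2 s1 s2 ll1 ll2; rewrite -E//.
    move/bigmax_seq_le : H => /(_ (leNye _) _ s1 ll1)/bigmax_seq_le.
    exact.
  apply/bigmax_seq_le => [|l1 s1 ll1]; first exact: leNye.
  apply/bigmax_seq_le => [|l2 s2 ll2]; first exact: leNye.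
  by rewrite E// H.
move=> s1 s2; rewrite lee_fin subr_le0 ler_pdivrMr//.
by rewrite addr_gt0// s0.
Qed.

Lemma grid_gt0 (R : realType) (lmax : R) (s : seq R) :
  is_grid lmax s -> {in s, forall x, 0 < x}.
Proof. by move=> [_ /(order_path_min lt_trans)/allP]. Qed.

Lemma av_bound (R : realType) (p : nat) (s : seq R) (b : R -> 'cV[R]_p)
    (bstar : 'cV[R]_p) (C Cbar lstar : R) : {in s, forall x, 0 < x} ->
  C <= Cbar -> lstar \in s ->
  (forall l, l \in s -> lstar <= l -> `|b l - bstar| <= C * l) ->
  exists lhat : R,
    [/\ is_min (av_set s b Cbar) lhat, lhat <= lstar
      & `|b lhat - bstar| <= 3 * Cbar * lstar].
Proof.
move=> s0 CCbar lstars H.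
have HC l : l \in s -> lstar <= l -> `|b l - bstar| <= Cbar * l.
  by move=> ls ll; rewrite (le_trans (H _ ls ll))// ler_pM2r// s0.
have avstar : av_set s b Cbar lstar.
  apply/av_setP => //; split=> // l1 l2 s1 s2 ll1 ll2.
  by rewrite (le_trans (ler_distD bstar _ _))// mulrDr lerD ?HC// distrC HC.
have [|lhat [avhat lhatlb]] := seq_has_min (s := s) _ avstar.
  by move=> l [].
exists lhat; split=> //; first exact: lhatlb.
have lelstar := lhatlb _ avstar.
have /av_setP -/(_ s0)[hats /(_ lhat lstar hats lstars (lexx _) lelstar) D] :=
  avhat.
(* A norm is at most [Cbar * lstar] with [lstar > 0]. The sign is needed to replace [Cbar * lhat] by
   [Cbar * lstar] at the end. *)
have Cbar0 : 0 <= Cbar.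
  by rewrite -(pmulr_lge0 _ (s0 _ lstars)) (le_trans _ (HC _ lstars (lexx _))).
rewrite (le_trans (ler_distD (b lstar) _ _))//.
rewrite (le_trans (lerD D (HC _ lstars (lexx _))))//.
by nra.
Qed.

Lemma measurable_bigmaxr (d : measure_display) (T : measurableType d)
    (R : realType) (I : Type) (s : seq I) (f : I -> T -> R) (x : R) :
  (forall i, measurable_fun setT (f i)) ->
  measurable_fun setT (fun w => \big[Num.max/x]_(i <- s) f i w).
Proof.
move=> mf; elim: s => [|i s IH].
  by under eq_fun do rewrite big_nil; exact: measurable_cst.
by under eq_fun do rewrite big_cons; exact: measurable_maxr.
Qed.

Lemma measurable_mx_norm (d : measure_display) (T : measurableType d)
    (R : realType) (m n : nat) (A : T -> 'M[R]_(m, n)) :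
  (forall i j, measurable_fun setT (fun w => A w i j)) ->
  measurable_fun setT (fun w => `|A w|).
Proof.
move=> mA; rewrite (_ : (fun w => _) =
    fun w => \big[Num.max/0]_(ij : 'I_m * 'I_n) `|A w ij.1 ij.2|).
  by apply: measurable_bigmaxr => ij; exact: measurableT_comp.
by apply/funext => w; rewrite -mx_normrE.
Qed.

(** The quantile is the infimum of the levels where the cdf reaches [q]; since [q > 0] and the cdf
    vanishes at [-oo], these are bounded below. *)
Lemma cdf_quantile (d : measure_display) (T : measurableType d) (R : realType)
    (P : probability T R) (X : {RV P >-> R}) (q : R) : 0 < q ->
  (exists x, (q%:E <= cdf X x)%E) ->
  exists x0, (q%:E <= cdf X x0)%E /\
    forall x, (q%:E <= cdf X x)%E -> x0 <= x.
Proof.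
move=> q0 [x1 qx1]; pose S := [set x | (q%:E <= cdf X x)%E].
have lbS : has_lbound S.
  have : \forall x \near -oo, (cdf X x < q%:E)%E.
    have /open_ereal_lt' : ((0 : \bar R) < q%:E)%E by rewrite lte_fin.
    exact: (cvg_cdfNy0 X).
  move=> [M [_ HM]]; exists M => x /= qx; rewrite leNgt; apply/negP => /HM.
  by rewrite ltNge qx.
have infS : has_inf S by split => //; exists x1.
exists (inf S); split; last by move=> x qx; exact: ge_inf.
(* Each [x > inf S] exceeds some point of [S], so the cdf is at least [q] there, and the right limit
   inherits the bound. *)
apply: cvge_to_ge (@cdf_right_continuous _ _ _ P X (inf S)) _.
near=> x.
have /inf_adherent/(_ infS)[y Sy] : 0 < x - inf S by rewrite subr_gt0.
rewrite subrKC => /ltW yx; exact: le_trans Sy (cdf_nondecreasing X yx).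
Unshelve. all: by end_near.
Qed.

(** All noise events are sublevel sets of one random variable, so their probabilities are values of
    its cdf. *)
Lemma noise_event_cdf (d : measure_display) (T : measurableType d)
    (R : realType) (P : probability T R) (n p : nat) (X : 'M[R]_(n, p))
    (eps : 'I_n -> {RV P >-> R}) :
  exists Z : {RV P >-> R}, forall l, noise_event X eps l = Z @^-1` `]-oo, l].
Proof.
pose f w := 4 * (`|X^T *m noise_vec eps w| / n%:R).
have mf : measurable_fun setT f.
  apply: measurable_funM => //; apply: measurable_funM => //.
  apply: measurable_mx_norm => i j.
  under eq_fun do rewrite mxE.
  apply: measurable_sum => k; apply: measurable_funM => //.
  by under eq_fun do rewrite mxE; exact: measurable_funPT.
exists (mfun_Sub (mem_set mf)) => l; apply/funext => w.
by rewrite /noise_event /= in_itv /= /f ler_pdivlMr// mulrC.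
Qed.

Theorem theorem3 (d : measure_display) (T : measurableType d) (R : realType)
    (P : probability T R) (n p : nat) (X : 'M[R]_(n, p)) (bstar : 'cV[R]_p)
    (eps : 'I_n -> {RV P >-> R})
    (heps : (\big[maxe/-oo]_(i < n) 'E_P[fun w => (eps i w ^+ 2)%R] < +oo)%E)
    (Lam : T -> seq R)
    (hLam : {ae P, forall w,
       is_grid (lambda_max X (response X bstar eps w)) (Lam w)})
    (bhat : R -> T -> 'cV[R]_p)
    (hbhat : forall (w : T) (lambda : R), 0 < lambda ->
       is_lasso X (response X bstar eps w) lambda (bhat lambda w))
    (C : R) (hC : linf_assumption X bstar eps Lam bhat C)
    (Cbar : R) (hCbar : C <= Cbar)
    (delta : R) (hdelta : 0 < delta < 1) :
  with_prob_at_least P (1 - delta)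
    [set w | forall lstar : R,
       is_min (oracle_set X eps delta (Lam w)) lstar ->
       exists lhat : R,
         [/\ is_min (av_set (Lam w) (fun l => bhat l w) Cbar) lhat,
             lhat <= lstar
           & `|bhat lhat w - bstar| <= 3 * Cbar * lstar]].
Proof.
move: hdelta => /andP[delta0 delta1].
have q0 : 0 < 1 - delta by rewrite subr_gt0.
have [Z ZE] := noise_event_cdf X eps.
have [|noq] := pselect (exists x, ((1 - delta)%:E <= cdf Z x)%E); last first.
  (* If no level reaches [1 - delta], every oracle set is empty and the claim is vacuous. *)
  exists setT; split=> //; last by rewrite probability_setT lee_fin gerBl ltW.
  by move=> w _ lstar [[_]]; rewrite ZE => qstar; case: noq; exists lstar.
move=> /(cdf_quantile q0)[l0 [ql0 l0le]].
have [N [mN N0 subN]] : {ae P, forall w,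
    is_grid (lambda_max X (response X bstar eps w)) (Lam w) /\
    forall l, l \in Lam w -> noise_event X eps l w ->
      `|bhat l w - bstar| <= C * l} by exact: filterI.
have mE : measurable (Z @^-1` `]-oo, l0]).
  by rewrite -[X in measurable X]setTI; exact: measurable_funPT.
(* The fixed quantile event, minus a null set [N] off which the grid and error hypotheses both
   hold. *)
exists (Z @^-1` `]-oo, l0] `\` N); split; first exact: measurableD.
- move=> w [/= Zl0 Nw] lstar [[lstars qstar] _].
  have [grid err] : is_grid (lambda_max X (response X bstar eps w)) (Lam w) /\
      forall l, l \in Lam w -> noise_event X eps l w ->
        `|bhat l w - bstar| <= C * l.
    by apply: contrapT => /subN.
  apply: (av_bound (grid_gt0 grid) hCbar lstars) => l ls lstarl.
  (* The chain is [Z w <= l0 <= lstar <= l]; the middle inequality is minimality of the quantile. *)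
  apply: err => //; rewrite ZE /= in_itv /=.
  rewrite in_itv /= in Zl0; rewrite (le_trans Zl0)// (le_trans _ lstarl)//.
  by apply: l0le; rewrite /cdf /distribution /= /pushforward -ZE.
- rewrite (le_trans ql0)// /cdf /distribution /= /pushforward.
  (* Adding the null set [N] back costs no probability and covers the whole quantile event. *)
  rewrite -(measureU0 (measurableD mE mN) mN N0) le_measure ?inE//.
    by apply: measurableU => //; exact: measurableD.
  by move=> w Zw; have [?|?] := pselect (N w); [right|left].
Qed.
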